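(* For every integer $n\geqslant 3$ there is no connected graph $\Gamma$ such that $\Upsilon^{\rm sym}_{\rm v}(sr_n,\Gamma)=(n+2)\,\Upsilon_{\rm v}(sr_n,\Gamma)>n+2$.
   Context: Graphs are undirected, without loops and multiple edges, and may be infinite. The tailed star $sr_n$ is the graph obtained from the star $K_{1,n}$ (a center joined to $n$ leaves) by adding one new vertex and an edge joining it to one leaf; it has $n+2$ vertices. A set $M\subseteq V(\Gamma)$ is marked (for a graph $K$) if every (not necessarily induced) subgraph of $\Gamma$ isomorphic to $K$ contains a vertex of $M$. $\Upsilon_{\rm v}(K,\Gamma)$ is the minimum cardinality of a marked set; $\Upsilon^{\rm sym}_{\rm v}(K,\Gamma)$ is the minimum cardinality of a marked set invariant under all automorphisms of $\Gamma$.
   Formalization: The two minimum cardinalities are taken to be finite numbers (the graph itself may be infinite); with infinite cardinals the claim fails, e.g. for the two-way infinite path with n pendant vertices attached to each vertex. *)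

(* Defs.v *)
From Stdlib Require Import Relation_Operators.
From mathcomp Require Import all_boot.
From mathcomp Require Import boolp classical_sets functions cardinality.

Set Implicit Arguments.
Unset Strict Implicit.
Unset Printing Implicit Defensive.

Local Open Scope classical_set_scope.
Local Open Scope card_scope.

Record sgraph : Type := SGraph {
  vert :> Type;
  adj : vert -> vert -> Prop;
  adj_sym : forall x y, adj x y -> adj y x;
  adj_irrefl : forall x, ~ adj x x
}.

Arguments adj {s}.

Definition connected_graph (G : sgraph) : Prop :=
  forall x y : G, clos_refl_trans G adj x y.

(* Not necessarily induced: sub_adj may omit edges of G between vertices of
   sub_vert. *)
Record subgraph (G : sgraph) : Type := Subgraph {
  sub_vert : set G;
  sub_adj : G -> G -> Prop;
  sub_adj_sym : forall x y, sub_adj x y -> sub_adj y x;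
  sub_adj_vert : forall x y, sub_adj x y -> sub_vert x;
  sub_adj_adj : forall x y, sub_adj x y -> adj x y
}.

Definition subgraph_iso (K G : sgraph) (H : subgraph G) : Prop :=
  exists2 f : K -> G, set_bij setT (sub_vert H) f &
    forall x y : K, adj x y <-> sub_adj H (f x) (f y).

Definition automorphism (G : sgraph) (f : G -> G) : Prop :=
  bijective f /\ forall x y : G, adj x y <-> adj (f x) (f y).

Definition marked (K G : sgraph) (M : set G) : Prop :=
  forall H : subgraph G, subgraph_iso K H -> M `&` sub_vert H !=set0.

Definition aut_invariant (G : sgraph) (M : set G) : Prop :=
  forall f : G -> G, automorphism f -> f @` M = M.

(* The family P contains a finite set, and the minimum of the (possibly
   infinite) cardinalities of its members is the natural number k. *)
Definition min_card (T : Type) (P : set T -> Prop) (k : nat) : Prop :=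
  (exists2 M, P M & M #= `I_k) /\ (forall M, P M -> `I_k #<= M).

Definition Upsilon_v_is (K G : sgraph) (k : nat) : Prop :=
  min_card (@marked K G) k.

Definition Upsilon_v_sym_is (K G : sgraph) (k : nat) : Prop :=
  min_card (fun M : set G => marked K M /\ aut_invariant M) k.

Inductive sr_vert (n : nat) : Type :=
  | Center
  | Leaf of 'I_n
  | Tail.

Arguments Center {n}.
Arguments Tail {n}.

(* The tail hangs on the leaf of index 0. *)
Definition sr_adj (n : nat) (x y : sr_vert n) : Prop :=
  match x, y with
  | Center, Leaf _ | Leaf _, Center => True
  | Leaf i, Tail | Tail, Leaf i => i = 0 :> nat
  | _, _ => False
  end.

Lemma sr_adj_sym (n : nat) (x y : sr_vert n) : sr_adj x y -> sr_adj y x.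
Proof. by case: x => [|i|]; case: y => [|j|]. Qed.

Lemma sr_adj_irrefl (n : nat) (x : sr_vert n) : ~ sr_adj x x.
Proof. by case: x => [|i|] /= []. Qed.

Definition sr (n : nat) : sgraph := SGraph (@sr_adj_sym n) (@sr_adj_irrefl n).

(* Main.v *)
Require Import Defs.
From mathcomp Require Import all_boot finmap zify.
From mathcomp Require Import boolp classical_sets functions cardinality.

(** Let w(x) be the proportion of minimum marked sets that contain the vertex x;
    there are only finitely many such sets, so no group averaging is needed. The
    vertices with w(x) >= 1/(n+2) form an invariant marked set N of at most
    (n+2) u vertices. If the symmetric optimum equals (n+2) u, then N contains
    every copy of sr_n, every vertex of N lies in a minimum marked set, and every
    minimum marked set meets every copy in exactly one vertex. The centers of the
    copies form an invariant marked subset of N, hence all of N; by connectedness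
    N is the whole graph, which is therefore finite with all vertices centers.

    Exchanging leaves shows that the graph is n-regular. Vertices at distance 2
    from a given vertex belong to the same minimum marked sets, so no copy
    contains two of them; hence for every edge lx at most one neighbor of x lies
    outside the closed neighborhood of l. This rigidity forces vertices c, x at
    distance 2 to have the same neighbors and, together with these, to exhaust
    the graph, which then has only n+2 vertices, contrary to (n+2) u > n+2. *)

Set Implicit Arguments.
Unset Strict Implicit.
Unset Printing Implicit Defensive.

Local Open Scope fset_scope.
Local Open Scope nat_scope.

(** The equality case of termwise comparison, by which a tight averaged bound becomes an exact value
    at each term. *)
Lemma sum_eq_pointwise (I : eqType) (s : seq I) (F G : I -> nat) :
  {in s, forall i, F i <= G i} -> \sum_(i <- s) G i <= \sum_(i <- s) F i ->
  {in s, F =1 G}.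
Proof.
elim: s => [|j s IH] // leFG; rewrite !big_cons => leGF.
have leFGs : {in s, forall i, F i <= G i}.
  by move=> i si; apply: leFG; rewrite inE si orbT.
have leFGj : F j <= G j by apply: leFG; rewrite inE eqxx.
have leS : \sum_(i <- s) F i <= \sum_(i <- s) G i.
  by rewrite big_seq [leqRHS]big_seq; apply: leq_sum.
move=> i; rewrite inE => /predU1P[-> | si]; first by lia.
by apply: IH => //; lia.
Qed.

(** * Minimum hitting sets and the cost of symmetry *)

Section HittingSets.

Variables (V : choiceType) (E : {fset V} -> Prop).

Definition hitting_set (T : {fset V}) :=
  forall e, E e -> exists2 x, x \in e & x \in T.

Definition exact_hitting_set (T : {fset V}) :=
  hitting_set T /\
  forall e x y, E e -> x \in e -> x \in T -> y \in e -> y \in T -> x = y.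

(* Bounded search tree: a partial hitting set that is too small misses some
   edge e, and each of its completions contains one of the finitely many
   vertices of e. *)
Lemma finitely_many_minimum_hitting_sets (u : nat) :
  (forall T, hitting_set T -> u <= #|` T|) ->
  exists s : seq {fset V}, forall T, hitting_set T -> #|` T| = u -> T \in s.
Proof.
move=> minu.
suff H j : forall A : {fset V}, #|` A| + j = u -> exists s : seq {fset V},
    forall T, A `<=` T -> hitting_set T -> #|` T| = u -> T \in s.
  have [|s Hs] := H u fset0; first by rewrite cardfs0.
  by exists s => T; apply: Hs; apply: fsub0set.
elim: j => [|j IH] A cA.
  exists [:: A] => T sAT _ cT; rewrite inE eq_sym eqEfcard sAT /=; lia.
have [trA|/existsNP[e /not_implyP[Ee nAe]]] := pselect (hitting_set A).
  by have := minu _ trA; lia.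
have branch x : exists s : seq {fset V}, x \in e -> forall T,
    x |` A `<=` T -> hitting_set T -> #|` T| = u -> T \in s.
  have [xe|] := boolP (x \in e); last by exists [::].
  have xA : x \notin A by apply/negP => xA; apply: nAe; exists x.
  have [|s Hs] := IH (x |` A); first by rewrite cardfsU1 xA; lia.
  by exists s.
have [F HF] := boolp.choice branch.
exists (flatten [seq F x | x <- e]) => T sAT trT cT.
have [x xe xT] := trT _ Ee.
apply/flattenP; exists (F x); first exact: map_f.
by apply: HF => //; rewrite fsubUset fsub1set xT.
Qed.

Variable Phi : (V -> V) -> Prop.
Hypothesis PhiV : forall f, Phi f -> exists2 g, Phi g & cancel f g /\ cancel g f.
Hypothesis PhiE : forall f e, Phi f -> E e -> E (f @` e).

Definition closed_under (N : {fset V}) := forall f x, Phi f -> x \in N -> f x \in N.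

Lemma hitting_set_image f T : Phi f -> hitting_set T -> hitting_set (f @` T).
Proof.
move=> Pf trT e Ee; have [g Pg [fK gK]] := PhiV Pf.
have [x /imfsetP[y /= ye ->] gyT] := trT _ (PhiE Pg Ee).
by exists y => //; apply/imfsetP; exists (g y).
Qed.

(* Averaging over the finite set of all minimum hitting sets bounds the cost of
   symmetry by k; the lemma extracts what equality says. *)
Lemma symmetrization_equality (k u : nat) :
  (forall e, E e -> #|` e| = k) ->
  (forall T, hitting_set T -> u <= #|` T|) ->
  (exists2 T, hitting_set T & #|` T| = u) ->
  (forall N, hitting_set N -> closed_under N -> k * u <= #|` N|) ->
  exists N, [/\ closed_under N, #|` N| = k * u, forall e, E e -> e `<=` N &
    forall x, x \in N -> exists2 T, exact_hitting_set T & x \in T].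
Proof.
move=> cE minu [T0 trT0 cT0] minN.
have [s0 Hs0] := finitely_many_minimum_hitting_sets minu.
pose s := undup [seq T : {fset V} <- s0 | `[< hitting_set T >] && (#|` T| == u)].
have sP T : reflect (hitting_set T /\ #|` T| = u) (T \in s).
  rewrite mem_undup mem_filter; apply: (iffP idP).
    by case/andP=> /andP[/asboolP trT /eqP cT].
  by case=> trT cT; rewrite (asboolT trT) cT eqxx Hs0.
have us : uniq s by apply: undup_uniq.
pose w x := count (fun T : {fset V} => x \in T) s.
(* Double counting of the pairs [x \in T] with [x] in [D] and [T] a minimum hitting set. *)
have sum_w (D : {fset V}) : \sum_(x <- D) w x = \sum_(T <- s) #|` D `&` T|.
  rewrite /w; under eq_bigr do rewrite -sum1_count big_mkcond.
  rewrite exchange_big; apply: eq_bigr => T _.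
  rewrite -big_mkcond sum1_count -size_filter.
  apply/perm_size/uniq_perm; [by apply/filter_uniq/fset_uniq|exact: fset_uniq|].
  by move=> x; rewrite mem_filter in_fsetI andbC.
set t := size s.
have t_gt0 : 0 < t.
  by rewrite -has_predT; apply/hasP; exists T0; rewrite ?inE //; apply/sP.
(* [U], the union of the minimum hitting sets, makes [N] a finite set. As [t > 0], the threshold on
   [w] already forces membership in [U]. *)
pose U := seq_fset tt (flatten [seq enum_fset T | T <- s]).
pose N := [fset x in U | t <= k * w x].
have NP x : (x \in N) = (t <= k * w x).
  rewrite !inE seq_fsetE; apply: andb_idl => tw.
  have /hasP[T sT xT] : has (fun T : {fset V} => x \in T) s.
    by rewrite has_count -/(w x); lia.
  by apply/flattenP; exists (enum_fset T) => //; apply: map_f.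
have ge1 e : E e -> {in s, forall T, 1 <= #|` e `&` T|}.
  move=> Ee T /sP[/(_ e Ee)[x xe xT] _].
  by rewrite cardfs_gt0; apply/fset0Pn; exists x; rewrite inE xe.
have sum_const (I : Type) (r : seq I) c : \sum_(i <- r) c = size r * c.
  by rewrite big_const_seq count_predT iter_addn_0 mulnC.
(* If [e] missed [N], its [k] vertices would all have [k * w x < t], so [w] would sum to less than
   [t] over [e], although each of the [t] minimum hitting sets meets [e]. *)
have trN : hitting_set N.
  move=> e Ee; apply: contrapT => eN0.
  have e_gt0 : 0 < #|` e|.
    have [x xe _] := trT0 _ Ee.
    by rewrite cardfs_gt0; apply/fset0Pn; exists x.
  have le_t : t <= \sum_(x <- e) w x.
    rewrite sum_w -[t]muln1 -sum_const big_seq [leqRHS]big_seq.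
    by apply: leq_sum => T /(ge1 _ Ee).
  have : \sum_(x <- e) (k * w x).+1 <= \sum_(x <- e) t.
    rewrite big_seq [leqRHS]big_seq; apply: leq_sum => x xe.
    by rewrite ltnNge -NP; apply/negP => xN; apply: eN0; exists x.
  under eq_bigr do rewrite -addn1.
  rewrite big_split /= !sum_const -big_distrr /= -(cE _ Ee) muln1.
  rewrite -[size e]/(#|` e|) in e_gt0 *; nia.
(* Taking images under [f] injects the minimum hitting sets through [x] into those through [f x]. *)
have le_w f x : Phi f -> w x <= w (f x).
  move=> Pf; rewrite /w -!size_filter.
  have [g Pg [fK gK]] := PhiV Pf.
  rewrite -(size_map (fun T : {fset V} => f @` T)); apply: uniq_leq_size.
    rewrite map_inj_uniq ?filter_uniq //.
    have mem_image A y : (f y \in f @` A) = (y \in A).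
      by apply: mem_imfset; apply: can_inj fK.
    by move=> A B AB; apply/fsetP => y; rewrite -mem_image AB mem_image.
  move=> _ /mapP[T + ->]; rewrite !mem_filter => /andP[xT /sP[trT cT]].
  apply/andP; split; first by apply/imfsetP; exists x.
  apply/sP; split; first exact: hitting_set_image.
  by rewrite card_imfset //; apply: can_inj fK.
have invN : closed_under N.
  by move=> f x Pf; rewrite !NP => /leq_trans; apply; rewrite leq_mul2l le_w ?orbT.
have leNu : \sum_(x <- N) w x <= t * u.
  rewrite sum_w -sum_const big_seq [leqRHS]big_seq; apply: leq_sum => T /sP[_ <-].
  exact/fsubset_leq_card/fsubsetIr.
(* With [leNu] this yields [#|N| <= k * u]; the lower bound [minN] then makes every inequality in
   the chain an equality. *)
have le_tN : t * #|` N| <= \sum_(x <- N) k * w x.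
  rewrite mulnC -sum_const big_seq [leqRHS]big_seq; apply: leq_sum => x.
  by rewrite NP.
have kuN := minN _ trN invN.
have cN : #|` N| = k * u.
  rewrite -big_distrr /= in le_tN; nia.
have w_eq : {in N, forall x, t = k * w x}.
  apply: (@sum_eq_pointwise _ N (fun=> t) (fun x => k * w x)) => [x|].
    by rewrite NP.
  rewrite sum_const -[size N]/(#|` N|) cN -big_distrr /=; nia.
have w_le x : k * w x <= t.
  have [/w_eq <- //|] := boolP (x \in N); rewrite NP -ltnNge; exact: ltnW.
(* Each minimum hitting set meets [e] at least once, while [k * w] is at most [t] at each of the [k]
   vertices of [e]. The two bounds on the sum of [w] over [e] coincide, so both are attained
   termwise. *)
have tight e : E e -> {in e, forall x, k * w x = t} /\
    {in s, forall T, 1 = #|` e `&` T|}.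
  move=> Ee.
  have le1 : t <= \sum_(x <- e) w x.
    rewrite sum_w -[t]muln1 -sum_const big_seq [leqRHS]big_seq.
    by apply: leq_sum => T /(ge1 _ Ee).
  have le2 : \sum_(x <- e) k * w x <= k * t.
    rewrite -[in leqRHS](cE _ Ee) -[#|` e|]/(size e) -sum_const.
    by apply: leq_sum => x _; apply: w_le.
  split.
    apply: sum_eq_pointwise => [//|].
    by rewrite sum_const -[size e]/(#|` e|) cE // -big_distrr /= leq_mul2l le1 orbT.
  apply: sum_eq_pointwise; first exact: ge1.
  rewrite -sum_w sum_const muln1 -/t.
  rewrite -big_distrr /= leq_mul2l in le2; case/orP: le2 => // /eqP k0.
  have [x xe _] := trT0 _ Ee.
  have /eqP := cE _ Ee; rewrite k0 cardfs_eq0 => /eqP e0.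
  by rewrite e0 in xe.
exists N; split => //.
  by move=> e Ee; apply/fsubsetP => x xe; rewrite NP (tight _ Ee).1.
move=> x; rewrite NP => tw.
have /hasP[T sT xT] : has (fun T : {fset V} => x \in T) s.
  by rewrite has_count -/(w x); lia.
exists T => //; split; first by case/sP: sT.
move=> e y z Ee ye yT ze zT.
have /esym/eqP/cardfs1P[a eTa] := (tight _ Ee).2 _ sT.
have : y \in e `&` T by rewrite inE ye.
have : z \in e `&` T by rewrite inE ze.
by rewrite eTa !inE => /eqP -> /eqP ->.
Qed.

End HittingSets.

(** * Copies of the tailed star as vertex sets *)

Section TailedStars.

Variables (V : choiceType) (r : rel V) (n : nat).
Hypotheses (r_sym : symmetric r) (r_irr : irreflexive r).

(* The tail t hangs on the leaf l of the star with center c, and Y is the set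
   of the other leaves. *)
Definition tailed_star (c l t : V) (Y : {fset V}) :=
  [/\ r c l, r l t, t != c, #|` Y|.+1 = n &
    {in Y, forall y, [&& r c y, y != l & y != t]}].

Definition tailed_star_set (e : {fset V}) :=
  exists c l t Y, tailed_star c l t Y /\ e = c |` (l |` (t |` Y)).

Lemma neq_of_rel x y : r x y -> x != y.
Proof. by move=> rxy; apply/eqP => xy; move: rxy; rewrite xy r_irr. Qed.

Lemma card_tailed_star_set e : tailed_star_set e -> #|` e| = n + 2.
Proof.
case=> c [l [t [Y [[cl lt tc cY HY] ->]]]].
have cl' := neq_of_rel cl; have lt' := neq_of_rel lt.
have cNY : c \notin Y by apply/negP => /HY /and3P[]; rewrite r_irr.
have lNY : l \notin Y by apply/negP => /HY /and3P[_]; rewrite eqxx.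
have tNY : t \notin Y by apply/negP => /HY /and3P[_ _]; rewrite eqxx.
rewrite !cardfsU1 !inE !negb_or cl' lt' [c == t]eq_sym tc cNY lNY tNY /=; lia.
Qed.

Lemma tailed_star_image f c l t Y :
  injective f -> (forall x y, r x y -> r (f x) (f y)) ->
  tailed_star c l t Y -> tailed_star (f c) (f l) (f t) (f @` Y).
Proof.
move=> f_inj f_hom [cl lt tc cY HY]; split; rewrite ?(inj_eq f_inj) ?f_hom //.
  by rewrite card_imfset.
move=> _ /imfsetP[y /= /HY /and3P[cy yl yt] ->].
by rewrite !(inj_eq f_inj) yl yt f_hom.
Qed.

Lemma tailed_star_set_image f e :
  injective f -> (forall x y, r x y -> r (f x) (f y)) ->
  tailed_star_set e -> tailed_star_set (f @` e).
Proof.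
move=> f_inj f_hom [c [l [t [Y [sY ->]]]]].
exists (f c), (f l), (f t), (f @` Y); split; first exact: tailed_star_image.
by rewrite !imfsetU1.
Qed.

(* Three leaves outside the edge from l to t can be exchanged pairwise: an
   exact hitting set through one of them would have to avoid the copy that
   uses the other two. *)
Lemma degree_bound c l t (Z : {fset V}) :
  2 < n ->
  (forall x, exists2 T, exact_hitting_set tailed_star_set T & x \in T) ->
  r c l -> r l t -> t != c ->
  {in Z, forall y, [&& r c y, y != l & y != t]} -> #|` Z| < n.
Proof.
move=> n_gt2 exactP cl lt tc HZ; rewrite ltnNge; apply/negP => nZ.
have star s : uniq s -> (size s).+1 = n -> {subset s <= Z} ->
    tailed_star_set (c |` (l |` (t |` [fset y in s]))).
  move=> us ss sZ; exists c, l, t, [fset y in s]; split=> //; split=> //.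
    by rewrite card_fseq undup_id.
  by move=> y; rewrite !inE => /sZ /HZ.
have uZ := fset_uniq Z.
have memZ y : y \in enum_fset Z -> y \in Z by [].
case: (enum_fset Z) uZ memZ nZ => [|y1 [|y2 [|y3 q]]] uZ memZ /= nZ; try lia.
(* Besides [l] a copy has [n - 1] leaves: two of [y1], [y2], [y3] and these [n - 3] shared ones. *)
pose p := take (n - 3) q.
have sp : (size p).+3 = n by rewrite size_takel; lia.
have pq : {subset p <= q} by move=> y /mem_take.
move: (uZ); rewrite /= !inE !negb_or.
case/and4P=> /and3P[n12 n13 n1q] /andP[n23 n2q] n3q uq.
have up : uniq p by apply: take_uniq.
have n1p : y1 \notin p by apply: contra n1q => /pq.
have n2p : y2 \notin p by apply: contra n2q => /pq.
have n3p : y3 \notin p by apply: contra n3q => /pq.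
have sub a b : a \in [:: y1; y2; y3] -> b \in [:: y1; y2; y3] ->
    {subset a :: b :: p <= Z}.
  move=> ha hb z; rewrite !inE => hz; apply: memZ; move: ha hb hz; rewrite !inE.
  by move=> ha hb /or3P[/eqP ->|/eqP ->|/pq ->]; rewrite ?ha ?hb ?orbT //;
    [case/or3P: ha => ->|case/or3P: hb => ->]; rewrite ?orbT.
have star2 a b : a != b -> a \notin p -> b \notin p -> a \in [:: y1; y2; y3] ->
    b \in [:: y1; y2; y3] ->
    tailed_star_set (c |` (l |` (t |` [fset y in a :: b :: p]))).
  move=> ab ap bp ha hb; apply: star; last exact: sub.
    by rewrite /= inE negb_or ab ap bp.
  by rewrite /= sp.
have m1 : y1 \in [:: y1; y2; y3] by rewrite !inE eqxx.
have m2 : y2 \in [:: y1; y2; y3] by rewrite !inE eqxx orbT.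
have m3 : y3 \in [:: y1; y2; y3] by rewrite !inE eqxx !orbT.
have e12 := star2 y1 y2 n12 n1p n2p m1 m2.
have e13 := star2 y1 y3 n13 n1p n3p m1 m3.
have e23 := star2 y2 y3 n23 n2p n3p m2 m3.
have [T [trT exT] y1T] := exactP y1.
have [z ze zT] := trT _ e23.
(* Every vertex of the copy with leaves [y2], [y3] lies in one of the two copies through [y1], so
   exactness leaves only [y1], which that copy omits. *)
have zy1 : z = y1.
  move: ze; rewrite !inE => /or4P[zc|zl|zt|/or3P[z2|z3|zp]].
  - by apply: exT e12 _ zT _ y1T; rewrite !inE ?zc ?eqxx ?orbT.
  - by apply: exT e12 _ zT _ y1T; rewrite !inE ?zl ?eqxx ?orbT.
  - by apply: exT e12 _ zT _ y1T; rewrite !inE ?zt ?eqxx ?orbT.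
  - by apply: exT e12 _ zT _ y1T; rewrite !inE ?z2 ?eqxx ?orbT.
  - by apply: exT e13 _ zT _ y1T; rewrite !inE ?z3 ?eqxx ?orbT.
  - by apply: exT e12 _ zT _ y1T; rewrite !inE ?zp ?eqxx ?orbT.
have /HZ/and3P[cy1 y1l y1t] : y1 \in Z by apply: memZ; rewrite inE eqxx.
move: ze; rewrite zy1 !inE (negPf y1l) (negPf y1t) (negPf n12) (negPf n13).
by rewrite (negPf n1p) eq_sym (negPf (neq_of_rel cy1)).
Qed.

(** * Rigidity of finite connected graphs with all vertices centers *)

Variable A : {fset V}.
Hypotheses (n_gt2 : 2 < n) (memA : forall x, x \in A) (cardA : n + 2 < #|` A|).
Hypothesis connA : forall (S : {fset V}) c, c \in S ->
  (forall x y, x \in S -> r x y -> y \in S) -> A `<=` S.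
Hypothesis centerA : forall c, exists l t Y, tailed_star c l t Y.
Hypothesis exactA :
  forall x, exists2 T, exact_hitting_set tailed_star_set T & x \in T.

Let nbr c := [fset x in A | r c x].

Let nbrP c x : (x \in nbr c) = r c x.
Proof. by rewrite !inE memA. Qed.

(** A copy centered at [c] gives degree at least [n], and [degree_bound] gives at most [n + 1].
    Without a vertex at distance 2 the graph would be the closed neighborhood of [c], with at most
    [n + 2] vertices. A tail at distance 2 is not a neighbor of [c], which improves the bound to
    [n]. *)
Lemma regular_with_second_neighbor c :
  #|` nbr c| = n /\ exists l x, [/\ r c l, r l x, x != c & ~~ r c x].
Proof.
have [l [t [Y [cl lt tc cY HY]]]] := centerA c.
have lNY : l \notin Y by apply/negP => /HY /and3P[_]; rewrite eqxx.
have n_le : n <= #|` nbr c|.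
  rewrite -cY; have -> : #|` Y|.+1 = #|` l |` Y| by rewrite cardfsU1 lNY.
  apply: fsubset_leq_card; apply/fsubsetP => y; rewrite nbrP !inE.
  by case/predU1P => [->|/HY /and3P[]].
have bound l' t' : r c l' -> r l' t' -> t' != c -> #|` nbr c `\ l' `\ t'| < n.
  move=> cl' lt' tc'; apply: degree_bound cl' lt' tc' _ => // y.
  by rewrite in_fsetD1 in_fsetD1 nbrP => /and3P[-> -> ->].
have [l' [x [cl' lx xc ncx]]] : exists l x, [/\ r c l, r l x, x != c & ~~ r c x].
  apply: contrapT => Nex.
  have := bound _ _ cl lt tc.
  have AS : A `<=` c |` nbr c.
    apply: (connA (c := c)); first by rewrite !inE eqxx.
    move=> x y; rewrite !in_fset1U !nbrP => /predU1P[->|cx] xy.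
      by rewrite xy orbT.
    apply: contrapT => /negP; rewrite negb_or => /andP[yc ncy].
    by apply: Nex; exists x, y.
  have := fsubset_leq_card AS; rewrite cardfsU1.
  have := cardfsD1 l (nbr c); have := cardfsD1 t (nbr c `\ l).
  by move: (_ \in _) (_ \in _) (_ \notin _) => [] [] []; lia.
split; last by exists l', x.
have := bound _ _ cl' lx xc.
have := cardfsD1 l' (nbr c); have := cardfsD1 x (nbr c `\ l').
rewrite in_fsetD1 !nbrP (negPf ncx) cl' andbF /=; lia.
Qed.

(** By regularity, a star at [c] whose tail is not a neighbor of [c] must use all neighbors of [c]
    as leaves. *)
Lemma copy_on_closed_neighborhood c l x :
  r c l -> r l x -> x != c -> ~~ r c x ->
  exists2 e, tailed_star_set e & forall z, (z \in e) = [|| z == x, z == c | r c z].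
Proof.
move=> cl lx xc ncx; have [cn _] := regular_with_second_neighbor c.
exists (c |` (l |` (x |` (nbr c `\ l)))).
  exists c, l, x, (nbr c `\ l); split=> //; split=> //.
    by have := cardfsD1 l (nbr c); rewrite nbrP cl cn.
  move=> y; rewrite in_fsetD1 nbrP => /andP[-> cy]; rewrite cy /=.
  by apply: contra ncx => /eqP <-.
move=> z; rewrite !in_fset1U in_fsetD1 nbrP.
by have [->|_] := eqVneq z l; rewrite ?cl ?orbT //= orbCA.
Qed.

(* Two such vertices z1, z2 would lie in exactly the same exact hitting sets,
   being the possible tails of the copies on the closed neighborhood of l, and
   yet they lie in a common copy centered at x. *)
Lemma private_neighbor_unique l x z1 z2 :
  r l x -> r x z1 -> r x z2 -> z1 != l -> z2 != l -> ~~ r l z1 -> ~~ r l z2 ->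
  z1 = z2.
Proof.
move=> lx xz1 xz2 z1l z2l nlz1 nlz2.
have [T [trT exT] z1T] := exactA z1.
have [e1 Ee1 e1P] := copy_on_closed_neighborhood lx xz1 z1l nlz1.
have [e2 Ee2 e2P] := copy_on_closed_neighborhood lx xz2 z2l nlz2.
have [w] := trT _ Ee2; rewrite e2P => we2 wT.
have z2T : z2 \in T.
  case/predU1P: we2 wT => [-> //|we1 wT].
  have ww : w = z1 by apply: exT Ee1 _ wT _ z1T; rewrite e1P ?eqxx // we1 orbT.
  by move: we1; rewrite ww (negPf z1l) (negPf nlz1).
have [_ [l' [x' [xl' lx' xx' nxx']]]] := regular_with_second_neighbor x.
have [e Ee eP] := copy_on_closed_neighborhood xl' lx' xx' nxx'.
by apply: exT Ee _ z1T _ z2T; rewrite eP ?xz1 ?xz2 !orbT.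
Qed.

(** If [p] were not adjacent to [c], then [p] and [x] would be two neighbors of [l] outside the
    closed neighborhood of [c]; the case of [x] is symmetric. *)
Lemma midpoint_neighbors c l x p :
  r c l -> r l x -> x != c -> ~~ r c x -> r l p -> p != c -> p != x ->
  r c p && r x p.
Proof.
move=> cl lx xc ncx lp pc px; apply/andP; split; apply: contrapT => /negP nr.
  by have := private_neighbor_unique cl lp lx pc xc nr ncx; apply/eqP.
have xl : r x l by rewrite r_sym.
have lc : r l c by rewrite r_sym.
have cx : c != x by rewrite eq_sym.
have nxc : ~~ r x c by rewrite r_sym.
by have := private_neighbor_unique xl lp lc px cx nr nxc; apply/eqP.
Qed.

Lemma no_finite_homogeneous_graph : False.
Proof.
have [c _] : exists c, c \in A.
  by apply/fset0Pn; rewrite -cardfs_gt0; lia.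
have [cn [l [x [cl lx xc ncx]]]] := regular_with_second_neighbor c.
have [xn _] := regular_with_second_neighbor x.
have [ln _] := regular_with_second_neighbor l.
have lc : r l c by rewrite r_sym.
have xl : r x l by rewrite r_sym.
pose L := nbr c `&` nbr x.
have LP p : (p \in L) = r c p && r x p by rewrite in_fsetI !nbrP.
have closL p q : p \in L -> r p q -> q != c -> q != x -> q \in L.
  rewrite !LP => /andP[cp xp] pq qc qx.
  by apply: midpoint_neighbors pq qc qx => //; rewrite r_sym.
(* [L] contains [l] and the [n - 2] neighbors of [l] other than [c] and [x]. *)
have cL : n <= #|` L|.+1.
  have : #|` l |` (nbr l `\ c `\ x)| <= #|` L|.
    apply: fsubset_leq_card; apply/fsubsetP => p.
    rewrite in_fset1U !in_fsetD1 nbrP LP => /predU1P[->|/and3P[px pc lp]].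
      by rewrite cl xl.
    exact: midpoint_neighbors lp pc px.
  rewrite cardfsU1 !in_fsetD1 nbrP r_irr !andbF /=.
  have := cardfsD1 c (nbr l); have := cardfsD1 x (nbr l `\ c).
  rewrite in_fsetD1 !nbrP xc lx lc /=; lia.
have cLx m : r c m -> r x m.
  move=> cm; apply: contrapT => /negP nxm.
  have [mn _] := regular_with_second_neighbor m.
  have mc : r m c by rewrite r_sym.
  (* Otherwise [m] would have [n - 1 >= 2] neighbors outside the closed neighborhood of [c], against
     [private_neighbor_unique] on the edge from [c] to [m]. *)
  have [p cp mp] : exists2 p, r c p & r m p.
    apply: contrapT => Nex.
    have nc p : r m p -> ~~ r c p.
      by move=> mp; apply/negP => cp; apply: Nex; exists p.
    have := cardfsD1 c (nbr m); rewrite nbrP mc mn => cD.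
    have [p1 p1D] : exists p1, p1 \in nbr m `\ c.
      by apply/fset0Pn; rewrite -cardfs_gt0; clear -cD n_gt2; lia.
    have := cardfsD1 p1 (nbr m `\ c); rewrite p1D => cD1.
    have [p2] : exists p2, p2 \in nbr m `\ c `\ p1.
      by apply/fset0Pn; rewrite -cardfs_gt0; clear -cD cD1 n_gt2; lia.
    move: p1D; rewrite !in_fsetD1 !nbrP => /andP[p1c mp1] /and3P[p21 p2c mp2].
    case/eqP: p21.
    exact: private_neighbor_unique cm mp2 mp1 p2c p1c (nc _ mp2) (nc _ mp1).
  have mL : m \notin L by rewrite LP (negPf nxm) andbF.
  have mx : m != x by apply: contra ncx => /eqP <-.
  have mc' : m != c := neq_of_rel mc.
  (* By [closL], [p] in [L] would bring its neighbor [m] into [L]. So [m], [p] and [L] supply at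
     least [n + 1] neighbors of [c]. *)
  have pL : p \notin L.
    by apply: contra mL => pL; apply: closL pL _ mc' mx; rewrite r_sym.
  have : #|` m |` (p |` L)| <= #|` nbr c|.
    apply: fsubset_leq_card; apply/fsubsetP => z.
    by rewrite !in_fset1U nbrP LP => /or3P[/eqP ->|/eqP ->|/andP[]].
  rewrite !cardfsU1 in_fset1U negb_or (neq_of_rel mp) mL pL cn !add1n.
  by move=> /leq_trans/(_ cL); rewrite ltnn.
have ncx_eq : nbr c = nbr x.
  apply/eqP; rewrite eqEfcard xn cn leqnn andbT.
  by apply/fsubsetP => z; rewrite !nbrP; apply: cLx.
have AS : A `<=` c |` (x |` nbr c).
  apply: (connA (c := c)); first by rewrite !inE eqxx.
  move=> p q; rewrite !in_fset1U nbrP => /or3P[/eqP ->|/eqP ->|cp] pq.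
  - by rewrite nbrP pq !orbT.
  - by rewrite ncx_eq nbrP pq !orbT.
  have [//|qc] := eqVneq q c; have [//|qx] := eqVneq q x.
  have : q \in L by apply: closL pq qc qx; rewrite LP cp cLx.
  by rewrite LP nbrP => /andP[].
have := fsubset_leq_card AS; rewrite !cardfsU1 cn.
by move: (_ \notin _) (_ \notin _) => [] []; lia.
Qed.

End TailedStars.

(** * From subgraph copies to vertex sets *)

Section Copies.

Variable G : sgraph.

Definition adjb (x y : {classic G}) : bool := `[< @adj G x y >].

Lemma adjbP x y : reflect (@adj G x y) (adjb x y).
Proof. exact: asboolP. Qed.

Lemma adjb_sym : symmetric adjb.
Proof. by move=> x y; apply/adjbP/adjbP => /adj_sym. Qed.

Lemma adjb_irr : irreflexive adjb.
Proof. by move=> x; apply/negP => /adjbP /adj_irrefl. Qed.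

(** With its converse below, this identifies marked sets with hitting sets: a vertex that hits [e]
    also hits [H]. *)
Lemma tailed_star_of_iso n (H : subgraph G) : subgraph_iso (sr n.+1) H ->
  exists2 e, tailed_star_set adjb n.+1 e & forall x, x \in e -> sub_vert H x.
Proof.
case=> f0 [fH f0_inj _] f_adj; pose f : sr_vert n.+1 -> {classic G} := f0.
have f_inj : injective f by move=> a b; apply: f0_inj; rewrite inE.
have f_hom a b : sr_adj a b -> adjb (f a) (f b).
  by move=> ab; apply/adjbP/(@sub_adj_adj _ H)/f_adj.
pose g (i : 'I_n) : {classic G} := f (Leaf (lift ord0 i)).
have leaf_inj : injective (@Leaf n.+1) by move=> i j [].
have g_inj : injective g by move=> i j /f_inj /leaf_inj /lift_inj.
have neq a b : a <> b -> f a != f b.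
  by move=> ab; apply/eqP => /f_inj.
exists (f Center |` (f (Leaf ord0) |` (f Tail |` [fset g i | i in 'I_n]))).
  exists (f Center), (f (Leaf ord0)), (f Tail), [fset g i | i in 'I_n].
  split=> //; split; try exact: f_hom; try exact: neq.
    by rewrite card_imfset //= -cardE card_ord.
  move=> _ /imfsetP[i _ ->]; rewrite f_hom //= !neq //.
move=> x; rewrite !in_fset1U => /or4P[/eqP ->|/eqP ->|/eqP ->|/imfsetP[i _ ->]];
  exact: fH.
Qed.

Lemma iso_of_tailed_star n e : tailed_star_set adjb n.+1 e ->
  exists2 H : subgraph G, subgraph_iso (sr n.+1) H &
    forall x : {classic G}, sub_vert H x -> x \in e.
Proof.
case=> c [l [t [Y [[cl lt tc [cY] HY] ->]]]].
(* Index 0 is reserved for the leaf carrying the tail, so the others are shifted by one into [Y]. As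
   [Y] has [n] elements, the default [c] is never reached. *)
pose f (a : sr_vert n.+1) : {classic G} := match a with
  | Center => c | Tail => t
  | Leaf i => if i == 0 :> nat then l else nth c Y i.-1
  end.
have leafY (i : 'I_n.+1) : i != 0 :> nat -> nth c Y i.-1 \in Y.
  by move=> i0; apply: mem_nth; have := ltn_ord i; rewrite cY; lia.
have f_hom a b : sr_adj a b -> adjb (f a) (f b).
  have cleaf (i : 'I_n.+1) : adjb c (f (Leaf i)).
    by rewrite /=; case: eqP => // /eqP /leafY /HY /and3P[].
  case: a => [|i|]; case: b => [|j|] //= ab; first exact: cleaf.
  - by rewrite adjb_sym; apply: cleaf.
  - by rewrite ab.
  - by rewrite ab adjb_sym.
have cl' := neq_of_rel adjb_irr cl; have lt' := neq_of_rel adjb_irr lt.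
have leafc i := neq_of_rel adjb_irr (f_hom (Leaf i) Center I).
have leaft i : f (Leaf i) != t.
  by rewrite /=; case: (eqVneq (i : nat) 0) => [_|/leafY /HY /and3P[]].
have f_inj : injective f.
  move=> [|i|] [|j|] // fab.
  - by case/eqP: (leafc j).
  - by case/eqP: tc.
  - by case/eqP: (leafc i).
  - congr Leaf; apply: val_inj; move: fab => /=.
    have lY : l \notin Y by apply/negP => /HY /and3P[_]; rewrite eqxx.
    case: eqP => [->|/eqP i0]; case: eqP => [->|/eqP j0] // fab.
    + by have := leafY _ j0; rewrite -fab (negPf lY).
    + by have := leafY _ i0; rewrite fab (negPf lY).
    move/eqP: fab; rewrite nth_uniq ?fset_uniq // -?[size Y]/(#|` Y|) ?cY.
    + by move: i0 j0; case: (val i) (val j) => [|i'] [|j'] // _ _ /eqP /= ->.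
    + by have := ltn_ord i; lia.
    + by have := ltn_ord j; lia.
  - by case/eqP: (leaft i).
  - by case/eqP: tc.
  - by case/eqP: (leaft j).
pose S : set G := [set x | exists a, f a = x]%classic.
(* Only images of edges of the star are kept, so that [f] reflects adjacency even when [G] has
   further edges between these vertices. *)
pose R (x y : G) := exists a b, [/\ sr_adj a b, f a = x & f b = y].
have R_sym x y : R x y -> R y x.
  by case=> a [b [ab ? ?]]; exists b, a; split=> //; apply: sr_adj_sym.
have R_vert x y : R x y -> S x by case=> a [b [_ <- _]]; exists a.
have R_adj x y : R x y -> adj x y.
  by case=> a [b [ab <- <-]]; apply/adjbP/f_hom.
exists (Subgraph R_sym R_vert R_adj).
  exists f.
    split=> [a _|a b _ _|x [a <-]]; [by exists a|exact: f_inj|by exists a].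
  move=> a b; split=> [ab|]; first by exists a, b.
  by case=> a' [b' [ab /f_inj <- /f_inj <-]].
move=> _ [[|i|] <-]; rewrite !in_fset1U ?eqxx ?orbT //=.
by case: (eqVneq (i : nat) 0) => [_|/leafY ->]; rewrite ?eqxx ?orbT.
Qed.

Lemma marked_hitting_set n (T : {fset {classic G}}) :
  marked (sr n.+1) ([set` T]%classic : set G) <->
  hitting_set (tailed_star_set adjb n.+1) T.
Proof.
split=> [mT e /iso_of_tailed_star[H isoH He]|trT H /tailed_star_of_iso[e Ee He]].
  by have [x [xT Hx]] := mT H isoH; exists x => //; apply: He.
by have [x xe xT] := trT _ Ee; exists x; split=> //; apply: He.
Qed.

Lemma automorphism_inverse (f : G -> G) : automorphism f ->
  exists2 g : G -> G, automorphism g & cancel f g /\ cancel g f.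
Proof.
case=> -[g fK gK] f_adj; exists g => //; split; first by exists f.
by move=> x y; split=> [xy|/f_adj]; [apply/f_adj; rewrite !gK|rewrite !gK].
Qed.

Lemma aut_invariantP (T : {fset {classic G}}) :
  closed_under (V := {classic G}) (@automorphism G) T ->
  aut_invariant ([set` T]%classic : set G).
Proof.
move=> invT f autf; apply/seteqP; split=> [_ [x /= xT <-]|x /= xT].
  exact: invT.
have [g autg [fK gK]] := automorphism_inverse autf.
by exists (g x); [exact: invT|exact: gK].
Qed.

End Copies.

(** * Reduction to a finite graph *)

Theorem theorem2p4 (n : nat) (hn : 3 <= n) :
  ~ exists (G : sgraph) (u usym : nat),
      [/\ connected_graph G,
          Upsilon_v_is (sr n) G u,
          Upsilon_v_sym_is (sr n) G usym,
          usym = (n + 2) * u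
        & n + 2 < usym].
Proof.
case: n hn => [//|n] hn [G [u [usym [conn vu vusym usymE ltusym]]]].
case: vu vusym => [[M0 mM0 cM0] minu] [_ minsym].
pose V : choiceType := {classic G}.
pose r : rel V := @adjb G; pose E := tailed_star_set r n.+1.
have minu' (T : {fset V}) : hitting_set E T -> u <= #|` T|.
  move=> /marked_hitting_set /minu.
  by rewrite -card_le_II (card_le_eqr (introT card_eq_fsetP (erefl #|` T|))).
have attained : exists2 T : {fset V}, hitting_set E T & #|` T| = u.
  have /finite_fsetP[T M0T] : finite_set (M0 : set V) by apply/finite_setP; exists u.
  exists T; first by apply/marked_hitting_set; rewrite -M0T.
  by apply/card_eq_fsetP; rewrite -M0T.
have minN (N : {fset V}) : hitting_set E N ->
    closed_under (V := V) (@automorphism G) N -> (n.+1 + 2) * u <= #|` N|.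
  move=> /marked_hitting_set mN /aut_invariantP iN.
  have := minsym _ (conj mN iN).
  by rewrite -usymE -card_le_II (card_le_eqr (introT card_eq_fsetP (erefl #|` N|))).
have aut_inj (f : V -> V) : @automorphism G f -> injective f by case=> /bij_inj.
have aut_hom (f : V -> V) : @automorphism G f -> forall x y, r x y -> r (f x) (f y).
  by case=> _ f_adj x y /adjbP /f_adj /adjbP.
have [|N [invN cN EN exN]] := symmetrization_equality (V := V) (E := E)
  (@automorphism_inverse G) _ (card_tailed_star_set (@adjb_irr G)) minu' attained minN.
  move=> f e autf; apply: tailed_star_set_image; [exact: aut_inj|exact: aut_hom].
pose C : {fset V} := [fset x in N | `[< exists l t Y, tailed_star r n.+1 x l t Y >]].
have CN : C `<=` N by apply/fsubsetP => x; rewrite !inE => /andP[].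
have CP c l t Y : tailed_star r n.+1 c l t Y -> c \in C.
  move=> sY; rewrite !inE; apply/andP; split; last by apply/asboolP; exists l, t, Y.
  have /EN /fsubsetP : E (c |` (l |` (t |` Y))) by exists c, l, t, Y.
  by apply; rewrite !inE eqxx.
(* The centers form an invariant hitting set inside [N], and [N] already has the least size of such
   a set. *)
have NC : N = C.
  apply/eqP; rewrite eq_sym eqEfcard CN cN; apply: minN.
    move=> e [c [l [t [Y [sY ->]]]]]; exists c; last exact: CP sY.
    by rewrite !inE eqxx.
  move=> f x autf; rewrite 2!inE => /andP[_ /asboolP[l [t [Y sY]]]].
  exact: CP (tailed_star_image (aut_inj _ autf) (aut_hom _ autf) sY).
have centerN c : c \in N -> exists l t Y, tailed_star r n.+1 c l t Y.
  by rewrite NC !inE => /andP[_ /asboolP].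
have closN x y : x \in N -> r x y -> y \in N.
  move=> /centerN[l [t [Y sY]]] xy.
  have eN : x |` (l |` (t |` Y)) `<=` N by apply: EN; exists x, l, t, Y.
  have [/(fsubsetP eN) //|yW] := boolP (y \in x |` (l |` (t |` Y))).
  have [yl yt yY] : [/\ y != l, y != t & y \notin Y].
    by split; apply: contra yW => yz; rewrite !in_fset1U yz ?orbT.
  case: sY => xl lt tx [cY] HY.
  (* Exchanging the leaf [z] for the neighbor [y] gives a copy through [y], and [N] contains every
     copy. *)
  have [z zY] : exists z, z \in Y by apply/fset0Pn; rewrite -cardfs_gt0 cY; lia.
  have /EN /fsubsetP : E (x |` (l |` (t |` (y |` (Y `\ z))))).
    exists x, l, t, (y |` (Y `\ z)); split=> //; split=> //.
      have := cardfsD1 z Y; rewrite zY cY => ->.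
      by rewrite cardfsU1 in_fsetD1 (negPf yY) andbF.
    move=> w; rewrite in_fset1U in_fsetD1 => /predU1P[->|/andP[_ /HY //]].
    by apply/and3P.
  by apply; rewrite !inE eqxx !orbT.
have reach (S : {fset V}) c : c \in S ->
    (forall x y, x \in S -> r x y -> y \in S) -> forall x, x \in S.
  move=> cS closS x; move: (conn c x) cS.
  elim=> [a b ab|//|a b d _ IH1 _ IH2] aS; last by apply: IH2; apply: IH1.
  by apply: closS aS _; apply/adjbP.
have ltN : n.+1 + 2 < #|` N| by rewrite cN -usymE.
have [c cN'] : exists c, c \in N by apply/fset0Pn; rewrite -cardfs_gt0; lia.
have memN := reach _ _ cN' closN.
apply: (@no_finite_homogeneous_graph V r n.+1 _ _ N) => //.
- exact: adjb_sym.
- exact: adjb_irr.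
- by move=> S d dS closS; apply/fsubsetP => x _; apply: reach dS closS x.
- by move=> d; apply: centerN.
- by move=> x; apply: exN.
Qed.
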